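(* Let $d\geq 2$, let $T$ be the $d$-regular rooted tree, and let $G\leq\operatorname{Aut}(T)$ be a finitely generated self-similar branch group with the subgroup induction property. Then, for each finitely generated subgroup $H\leq G$ and each normal subgroup $N\trianglelefteq H$, the group $N$ is finitely generated and closed in the profinite topology on $G$. In particular, $G$ is subgroup separable.
   Context: A group is subgroup separable (LERF) if all of its finitely generated subgroups are closed in its profinite topology. The vertices of the $d$-regular rooted tree $T$ are identified with the words in $\{1,\dots,d\}^*$; the root is the empty word, the children of $v$ are $v1,\dots,vd$, and $\mathcal L_n$ is the set of words of length $n$. $\operatorname{Aut}(T)$ is the group of automorphisms of $T$ (fixing the root). For a vertex $v$, $T_v$ is the subtree of all words with prefix $v$. For $g\in\operatorname{Aut}(T)$ and a vertex $v$, the section $\varphi_v(g)\in\operatorname{Aut}(T)$ is the unique automorphism with $g\cdot(vw)=(g\cdot v)(\varphi_v(g)\cdot w)$ for all $w\in T$; $\varphi_v$ is a homomorphism on the stabilizer of $v$. For $G\leq\operatorname{Aut}(T)$ and a set $V$ of vertices, $\operatorname{Stab}_G(V)$ is the pointwise stabilizer of $V$ in $G$. $\operatorname{Rist}_G(v)$ is the subgroup of elements of $G$ acting trivially outside $T_v$, and $\operatorname{Rist}_G(\mathcal L_n)$ is the subgroup generated by all $\operatorname{Rist}_G(v)$, $v\in\mathcal L_n$. $G$ is branch if it acts transitively on every $\mathcal L_n$, all $\operatorname{Rist}_G(v)$ are infinite, and every $\operatorname{Rist}_G(\mathcal L_n)$ has finite index in $G$. $G$ is self-similar if $\varphi_v(G)\leq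 G$ for all vertices $v$. Let $G$ be self-similar. A class $\mathcal X$ of subgroups of $G$ is inductive if: (A) $\{1\}\in\mathcal X$ and $G\in\mathcal X$; (B) if $H\leq L$ are subgroups of $G$ with $[L:H]$ finite and $H\in\mathcal X$, then $L\in\mathcal X$; (C) if $H$ is a finitely generated subgroup of $\operatorname{Stab}_G(\mathcal L_1)$ and $\varphi_v(H)\in\mathcal X$ for all $v\in\mathcal L_1$, then $H\in\mathcal X$. $G$ has the subgroup induction property if every inductive class of subgroups of $G$ contains every finitely generated subgroup of $G$. *)

(* Defs.v *)
From HB Require Import structures.
From mathcomp Require Import all_boot.
From mathcomp Require Import boolp classical_sets functions cardinality.

Set Implicit Arguments.
Unset Strict Implicit.
Unset Printing Implicit Defensive.

Local Open Scope classical_set_scope.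
Local Open Scope group_scope.

Section Groups.
Variable gT : groupType.
Implicit Types (A H K L N G : set gT) (C : set (set gT)).

Definition subgroup H := H 1 /\ forall x y, H x -> H y -> H (x / y).

Definition subgroup_of H L := subgroup H /\ H `<=` L.

Definition normal_in N H :=
  subgroup_of N H /\ forall x h, N x -> H h -> N (x ^ h).

Definition gen A : set gT :=
  \bigcap_(H in [set H | subgroup H /\ A `<=` H]) H.

Definition fin_gen H := exists2 S : set gT, finite_set S & H = gen S.

Definition left_coset x H : set gT := [set x * h | h in H].

Definition finite_index H L := finite_set [set left_coset x H | x in L].

(* The profinite topology on [G]: the cosets of the finite index normal
   subgroups of [G] form a base of open sets. *)
Definition profinite_open G A := A `<=` G /\
  forall g, A g -> exists K,
    [/\ normal_in K G, finite_index K G & left_coset g K `<=` A].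

Definition profinite_closed G A := A `<=` G /\ profinite_open G (G `\` A).

Definition subgroup_separable G :=
  forall H, subgroup_of H G -> fin_gen H -> profinite_closed G H.

End Groups.

Definition word (d : nat) := seq 'I_d.

Section TreeAutomorphisms.
Variable d : nat.
Implicit Types (u v w : word d).

Definition adjacent u v :=
  (exists x, v = rcons u x) \/ (exists x, u = rcons v x).

Record aut := Aut {
  aut_fun :> word d -> word d;
  aut_inv : word d -> word d;
  autK : cancel aut_fun aut_inv;
  autVK : cancel aut_inv aut_fun;
  aut_root : aut_fun [::] = [::];
  aut_adj : forall u v, adjacent (aut_fun u) (aut_fun v) <-> adjacent u v }.

Implicit Types g h k : aut.

Lemma aut_eq g h : g =1 h -> g = h.
Proof.
case: g h => [g g' gK gVK g1 gA] [h h' hK hVK h1 hA] /= /funext E.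
subst h; have E : g' = h' by apply: funext => w; rewrite -[w in LHS]hVK gK.
by subst h'; congr Aut; exact: Prop_irrelevance.
Qed.

Definition aut1 : aut.
Proof. by exists id id. Defined.

Definition autV g : aut.
Proof.
exists (aut_inv g) g; [exact: autVK|exact: autK| |].
- by rewrite -{1}(aut_root g) autK.
- by move=> u v; rewrite -(aut_adj g) !autVK.
Defined.

(* [autM g h] applies [h] first: automorphisms act on the left. *)
Definition autM g h : aut.
Proof.
exists (fun w => g (h w)) (fun w => aut_inv h (aut_inv g w)).
- by move=> w; rewrite !autK.
- by move=> w; rewrite !autVK.
- by rewrite !aut_root.
- by move=> u v; rewrite !aut_adj.
Defined.

HB.instance Definition _ := gen_eqMixin aut.
HB.instance Definition _ := gen_choiceMixin aut.

Fact autMA : associative autM. Proof. by move=> g h k; exact: aut_eq. Qed.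
Fact aut1M : left_id aut1 autM. Proof. by move=> g; exact: aut_eq. Qed.
Fact autM1 : right_id aut1 autM. Proof. by move=> g; exact: aut_eq. Qed.
Fact autVM : left_inverse aut1 autV autM.
Proof. by move=> g; apply: aut_eq => w /=; rewrite autK. Qed.
Fact autMV : right_inverse aut1 autV autM.
Proof. by move=> g; apply: aut_eq => w /=; rewrite autVK. Qed.

HB.instance Definition _ := isGroup.Build aut autMA aut1M autM1 autVM autMV.

Lemma aut_child g u x : exists y, g (rcons u x) = rcons (g u) y.
Proof.
elim/last_ind: u x => [|u z IH] x.
  have /(aut_adj g) : adjacent [::] (rcons [::] x) by left; exists x.
  case=> [//|[y]]; rewrite aut_root => /(congr1 size).
  by rewrite size_rcons.
have /(aut_adj g) : adjacent (rcons u z) (rcons (rcons u z) x).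
  by left; exists x.
case=> [//|[y]]; have [t ->] := IH z.
move=> /rcons_inj[/(can_inj (autK g))/(congr1 size)].
by rewrite !size_rcons => /eqP; rewrite -addn2 -[X in X == _]addn0 eqn_add2l.
Qed.

Lemma size_aut g w : size (g w) = size w.
Proof.
elim/last_ind: w => [|w x IH]; first by rewrite aut_root.
by have [y ->] := aut_child g w x; rewrite !size_rcons IH.
Qed.

Definition section_fun g v w : word d := drop (size v) (g (v ++ w)).

Lemma section_funE g v w : g (v ++ w) = g v ++ section_fun g v w.
Proof.
rewrite /section_fun; elim/last_ind: w => [|w x IH].
  by rewrite cats0 drop_oversize ?size_aut// cats0.
rewrite -rcons_cat; have [y ->] := aut_child g (v ++ w) x.
by rewrite IH rcons_cat -(size_aut g v) !drop_size_cat.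
Qed.

Lemma adjacent_cat v u w : adjacent (v ++ u) (v ++ w) <-> adjacent u w.
Proof.
have catI (s t : word d) : v ++ s = v ++ t -> s = t.
  by move=> /eqP; rewrite eqseq_cat// eqxx => /eqP.
split=> -[] [x E]; [left|right|left|right]; exists x.
- by apply: catI; rewrite E rcons_cat.
- by apply: catI; rewrite E rcons_cat.
- by rewrite E rcons_cat.
- by rewrite E rcons_cat.
Qed.

Definition section g v : aut.
Proof.
exists (section_fun g v) (section_fun (autV g) (g v)).
- move=> w; rewrite {1}/section_fun -section_funE /= autK.
  by rewrite size_aut drop_size_cat.
- move=> w; rewrite {1}/section_fun.
  have := section_funE (autV g) (g v) w; rewrite [autV g (g v)]/= autK => <-.
  by rewrite /= autVK -(size_aut g v) drop_size_cat.
- by rewrite /section_fun cats0 drop_oversize ?size_aut.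
- by move=> u w; rewrite -(adjacent_cat (g v)) -!section_funE aut_adj adjacent_cat.
Defined.

Lemma sectionE g v w : g (v ++ w) = g v ++ section g v w.
Proof. exact: section_funE. Qed.

Lemma section_unique g v h :
  (forall w, g (v ++ w) = g v ++ h w) -> h = section g v.
Proof.
move=> E; apply: aut_eq => w; apply/eqP.
by have /eqP := E w; rewrite sectionE eqseq_cat// eqxx eq_sym.
Qed.

Implicit Types (G H : set aut) (V : set (word d)) (X : set (set aut)).

Definition level n : set (word d) := [set v | size v = n].

Definition stab G V : set aut := [set g | G g /\ forall v, V v -> g v = v].

Definition rist G v : set aut :=
  [set g | G g /\ forall w, ~~ prefix v w -> g w = w].

Definition rist_level G n : set aut := gen (\bigcup_(v in level n) rist G v).

Definition level_transitive G := forall n u v,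
  level n u -> level n v -> exists2 g, G g & g u = v.

Definition branch G := [/\ level_transitive G,
  forall v, infinite_set (rist G v) &
  forall n, finite_index (rist_level G n) G].

Definition self_similar G := forall g v, G g -> G (section g v).

Definition section_set H v : set aut := [set section h v | h in H].

Record inductive_class G X : Prop := {
  inductive_sub : forall H, X H -> subgroup_of H G;
  inductive_trivial : X [set 1];
  inductive_whole : X G;
  inductive_finite_index : forall H L,
    subgroup_of L G -> subgroup_of H L -> finite_index H L -> X H -> X L;
  inductive_sections : forall H,
    subgroup_of H (stab G (level 1)) -> fin_gen H ->
    (forall v, level 1 v -> X (section_set H v)) -> X H }.

Definition subgroup_induction G := forall X, inductive_class G X ->
  forall H, subgroup_of H G -> fin_gen H -> X H.

End TreeAutomorphisms.

(* Main.v *)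
Require Import Defs.
From mathcomp Require Import all_boot.
From mathcomp Require Import boolp classical_sets functions cardinality.

(** The subgroup induction property says that a property of subgroups holds for
    all finitely generated ones as soon as it defines an inductive class, and
    the theorem follows from two inductive classes.

    The first one shows that [G] is a torsion group
    ([torsion_subgroup_induction]).  Consider the subgroups that are torsion
    or not virtually abelian.  A branch group is not virtually abelian, virtual
    abelianness passes to subgroups and to sections, and an element of the
    first level stabiliser all of whose sections have finite order has finite
    order, so the class is inductive.  It contains the cyclic subgroups of [G],
    and these are abelian.

    Consequently every non-trivial normal subgroup [N] of [G] has finite index
    ([finite_index_normal]).  If [g] in [N] moves the vertex [w] of level [n],
    the usual commutator trick for branch groups puts the commutator subgroup
    of the rigid stabiliser [R] of level [n] inside [N].  As [R] has finite
    index in [G], it is finitely generated, so [R / (N `&` R)] is abelian,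
    torsion and finitely generated, that is, finite.

    The second class consists of the subgroups all of whose normal subgroups
    are finitely generated and closed in [G].  The trivial subgroup belongs to
    it because [G] is residually finite, and [G] by the previous paragraph.
    Passing to a finite index overgroup adds finitely many generators and
    finitely many cosets.  The substance is in the third closure property: a
    subgroup [H] of the first level stabiliser [K] is a subdirect product of
    its sections, and both finite generation and closedness of normal
    subgroups must be transferred from the factors to [H].

    To do this, a normal subgroup [N] of [H] is studied modulo the normal
    subgroups of [K] cut out by the sections: modulo the kernel of one section
    everything is known, because homomorphisms are continuous
    ([fin_gen_mod_kernel], [closed_mod_kernel]), and what holds modulo [A] and
    modulo [B] for all normal subgroups of [H] holds modulo [A `&` B]
    ([fin_gen_mod_meet], [closed_mod_meet]).  The kernels of all sections of the
    first level meet trivially.  In [closed_mod_meet] it is essential that the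
    hypotheses concern all normal subgroups of [H], since they are applied to
    other normal subgroups than the [N] of the conclusion. *)

Set Implicit Arguments.
Unset Strict Implicit.
Unset Printing Implicit Defensive.

Local Open Scope classical_set_scope.
Local Open Scope group_scope.

Ltac group_word := rewrite ?conjgE ?commgEl ?conjgE
  ?(invgM, invgK, invg1, mulgA, mul1g, mulg1, mulgK, mulgVK, mulgV, mulVg)//.

(** * Subgroups and generation *)

Section Groups.
Variable gT : groupType.
Implicit Types (A B H K L M N S U V : set gT) (x y g : gT).

Lemma subgroupV H x : subgroup H -> H x -> H x^-1.
Proof. by case=> H1 HF Hx; rewrite -[x^-1]mul1g; apply: HF. Qed.

Lemma subgroupM H x y : subgroup H -> H x -> H y -> H (x * y).
Proof.
by move=> sH Hx Hy; rewrite -[y]invgK; case: (sH) => _; apply=> //;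
  apply: subgroupV.
Qed.

Lemma subgroupMl H x y : subgroup H -> H x -> H (x * y) -> H y.
Proof.
move=> sH Hx Hxy; rewrite -(mulKg x y).
by apply: subgroupM => //; apply: subgroupV.
Qed.

Lemma subgroupMr H x y : subgroup H -> H y -> H (x * y) -> H x.
Proof.
move=> sH Hy Hxy; rewrite -(mulgK y x).
by apply: subgroupM => //; apply: subgroupV.
Qed.

Lemma subgroupX H x n : subgroup H -> H x -> H (x ^+ n).
Proof.
move=> sH Hx; elim: n => [|n IH]; first by case: sH.
by rewrite expgS; apply: subgroupM.
Qed.

Lemma subgroupJ H x y : subgroup H -> H x -> H y -> H (x ^ y).
Proof.
move=> sH Hx Hy; rewrite conjgE; apply: subgroupM => //; first exact: subgroupV.
exact: subgroupM.
Qed.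

Lemma subgroupI H K : subgroup H -> subgroup K -> subgroup (H `&` K).
Proof.
move=> [H1 HF] [K1 KF]; split=> // x y [Hx Kx] [Hy Ky].
by split; [apply: HF|apply: KF].
Qed.

Lemma subgroup1 : subgroup [set (1 : gT)].
Proof. by split=> // x y -> ->; rewrite invg1 mulg1. Qed.

Lemma normalJV N H x h : normal_in N H -> subgroup H -> N (x ^ h) -> H h -> N x.
Proof.
move=> nN sH Nxh Hh; rewrite -(conjgK h x).
by case: nN => _; apply=> //; apply: subgroupV.
Qed.

Lemma normal_refl H : subgroup H -> normal_in H H.
Proof. by move=> sH; split=> [//|x h]; [split|apply: subgroupJ]. Qed.

Lemma gen_subgroup A : subgroup (gen A).
Proof.
split=> [H [[]]//|x y Ax Ay H HA]; have [[_ HF] _] := HA.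
by apply: HF; [apply: Ax|apply: Ay].
Qed.

Lemma sub_gen A : A `<=` gen A.
Proof. by move=> x Ax H [_]; apply. Qed.

Lemma gen_sub A H : subgroup H -> A `<=` H -> gen A `<=` H.
Proof. by move=> sH AH x; apply. Qed.

Lemma genS A B : A `<=` B -> gen A `<=` gen B.
Proof.
move=> AB; apply: gen_sub; first exact: gen_subgroup.
by move=> x /AB; apply: sub_gen.
Qed.

Lemma fin_genP H : subgroup H ->
  fin_gen H <-> exists2 s : seq gT, [set` s] `<=` H & H `<=` gen [set` s].
Proof.
move=> sH; split=> [[S /finite_seqP[s ->] ->]|[s sS HS]].
  by exists s => //; apply: sub_gen.
exists [set` s]; first exact: finite_seq.
by apply/seteqP; split=> //; apply: gen_sub.
Qed.

(** Since [[~ x * y, z] = [~ x, z] ^ y * [~ y, z]], a commutator of products is a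
    product of commutators only up to conjugation, whence the normality of [N]. *)
Lemma gen_commutators N A : subgroup N ->
  (forall x h, N x -> gen A h -> N (x ^ h)) ->
  (forall x y, A x -> A y -> N [~ x, y]) ->
  forall x y, gen A x -> gen A y -> N [~ x, y].
Proof.
move=> sN nN AN; have sA := gen_subgroup A.
have step B : B `<=` gen A -> (forall x y, A x -> B y -> N [~ x, y]) ->
    forall x y, gen A x -> B y -> N [~ x, y].
  move=> BA ABN x y Ax By.
  suff [] : (gen A `&` [set x | forall y, B y -> N [~ x, y]]) x by move=> _; apply.
  move: x Ax; apply: gen_sub; last first.
    by move=> x Ax; split; [apply: sub_gen|move=> z Bz; apply: ABN].
  split=> [|a b [Aa aN] [Ab bN]].
    by split=> [|z _]; [case: sA|rewrite comm1g; case: sN].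
  split=> [|z Bz]; first by case: sA => _; apply.
  have -> : [~ a * b^-1, z] = [~ a, z] ^ b^-1 * ([~ b, z]^-1) ^ b^-1.
    by group_word.
  have AbV := subgroupV sA Ab.
  apply: subgroupM => //; apply: nN => //; first exact: aN.
  by apply: subgroupV => //; apply: bN.
have AgenA : forall x y, A x -> gen A y -> N [~ x, y].
  move=> x y Ax Ay; rewrite -invgR; apply: subgroupV => //.
  exact: (step A (@sub_gen A) AN).
exact: step.
Qed.

(** * Finite index *)

Lemma left_cosetP H x y : subgroup H ->
  left_coset x H = left_coset y H <-> H (x^-1 * y).
Proof.
move=> sH; split=> [E|Hxy].
  have : left_coset y H y by exists 1; [case: sH|rewrite mulg1].
  by rewrite -E => -[h Hh <-]; rewrite mulKg.
apply/seteqP; split=> _ [h Hh <-].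
  exists ((x^-1 * y)^-1 * h); last by group_word.
  by apply: subgroupM => //; apply: subgroupV.
exists (x^-1 * y * h); last by group_word.
exact: subgroupM.
Qed.

(** Finite index says that some function with finitely many values separates
    the cosets; in this form intersections, preimages and restrictions of
    finite index subgroups are immediate. *)
Lemma finite_indexP H L : subgroup H ->
  finite_index H L <-> exists (I : Type) (f : gT -> I),
    finite_set (f @` L) /\
    forall x y, L x -> L y -> f x = f y -> H (x^-1 * y).
Proof.
move=> sH; split=> [fH|[I [f [ff fH]]]].
  by exists _, (fun x => left_coset x H); split=> // x y _ _ /left_cosetP; apply.
have [g gP] : exists g : I -> gT, forall i, (f @` L) i -> L (g i) /\ f (g i) = i.
  suff /choice[g gP] : forall i, exists x, (f @` L) i -> L x /\ f x = i.
    by exists g.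
  move=> i.
  by have [[x Lx fx]|ni] := pselect ((f @` L) i); [exists x|exists 1].
apply: sub_finite_set (finite_image (fun i => left_coset (g i) H) ff).
move=> _ [x Lx <-]; exists (f x); first by exists x.
have [Lg Eg] : L (g (f x)) /\ f (g (f x)) = f x by apply: gP; exists x.
by apply/left_cosetP => //; apply: fH.
Qed.

Lemma finite_index_reps H L : subgroup H -> finite_index H L ->
  exists2 s : seq gT, [set` s] `<=` L &
    forall x, L x -> exists2 t, t \in s & H (t^-1 * x).
Proof.
move=> sH; rewrite /finite_index => fH.
have [g gP] : exists g : set gT -> gT, forall C,
    [set left_coset x H | x in L] C -> L (g C) /\ left_coset (g C) H = C.
  suff /choice[g gP] : forall C, exists x,
      [set left_coset x H | x in L] C -> L x /\ left_coset x H = C.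
    by exists g.
  move=> C.
  have [[x Lx E]|ni] := pselect ([set left_coset x H | x in L] C).
    by exists x.
  by exists 1.
have /finite_seqP[s Es] := finite_image g fH.
exists s => [x|x Lx].
  by rewrite -Es => -[C CL <-]; have [] := gP C CL.
have CL : [set left_coset x H | x in L] (left_coset x H) by exists x.
exists (g (left_coset x H)).
  have : [set` s] (g (left_coset x H)) by rewrite -Es; exists (left_coset x H).
  by [].
by apply/left_cosetP => //; have [] := gP _ CL.
Qed.

Lemma finite_index_of_reps H L (s : seq gT) : subgroup H ->
  (forall x, L x -> exists2 t, t \in s & H (t^-1 * x)) -> finite_index H L.
Proof.
move=> sH sP; apply:
  sub_finite_set (finite_image (fun x => left_coset x H) (finite_seq s)).
move=> _ [x Lx <-]; have [t ts Ht] := sP x Lx.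
by exists t => //; apply/left_cosetP.
Qed.

Lemma finite_index_refl H : subgroup H -> finite_index H H.
Proof.
move=> sH; apply: (@finite_index_of_reps _ _ [:: 1]) => // x Hx.
by exists 1; rewrite ?inE ?eqxx // invg1 mul1g.
Qed.

Lemma finite_indexS H K L M : subgroup H -> subgroup K ->
  H `<=` K -> M `<=` L -> finite_index H L -> finite_index K M.
Proof.
move=> sH sK HK ML /(finite_indexP _ sH)[I [f [ff fH]]].
apply/finite_indexP => //; exists I, f; split.
  by apply: sub_finite_set ff; apply: image_subset.
by move=> x y Mx My E; apply/HK/fH => //; apply: ML.
Qed.

Lemma finite_indexI H K L : subgroup H -> subgroup K ->
  finite_index H L -> finite_index K L -> finite_index (H `&` K) L.
Proof.
move=> sH sK /(finite_indexP _ sH)[I [f [ff fH]]].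
move=> /(finite_indexP _ sK)[J [g [fg gK]]].
apply/finite_indexP; first exact: subgroupI.
exists (I * J)%type, (fun x => (f x, g x)); split.
  apply: sub_finite_set (finite_setX ff fg).
  by move=> _ [x Lx <-]; split; exists x.
by move=> x y Lx Ly [Ef Eg]; split; [apply: fH|apply: gK].
Qed.

(** The index compares cosets only and makes sense for [H] not contained in
    [M]; the intersection turns [H] into a subgroup of [M]. *)
Lemma finite_index_trace H L M : subgroup H -> subgroup M ->
  M `<=` L -> finite_index H L -> finite_index (H `&` M) M.
Proof.
move=> sH sM ML fH; apply: finite_indexI => //; last exact: finite_index_refl.
exact: (finite_indexS sH sH _ ML fH).
Qed.

Lemma finite_index_trans H K L : subgroup H -> subgroup K ->
  finite_index H K -> finite_index K L -> finite_index H L.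
Proof.
move=> sH sK /(finite_index_reps sH)[s sK' sP] /(finite_index_reps sK)[t tL tP].
apply: (@finite_index_of_reps _ _ [seq y * x | y <- t, x <- s]) => // x Lx.
have [y yt Ky] := tP x Lx; have [z zs Hz] := sP _ Ky.
exists (y * z); first exact: allpairs_f.
by move: Hz; group_word.
Qed.

Lemma finite_index_bigI (I : eqType) (s : seq I) (U : I -> set gT) L :
  subgroup L -> (forall i, i \in s -> subgroup (U i) /\ finite_index (U i) L) ->
  subgroup (L `&` [set x | forall i, i \in s -> U i x]) /\
  finite_index (L `&` [set x | forall i, i \in s -> U i x]) L.
Proof.
move=> sL; elim: s => [|i s IH] sP.
  have -> : L `&` [set x | forall i, i \in [::] -> U i x] = L.
    by apply/seteqP; split=> [x []|x Lx].
  by split=> //; apply: finite_index_refl.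
have [sU fU] := sP i (mem_head _ _).
have [|sI fI] := IH; first by move=> j js; apply: sP; rewrite inE js orbT.
have -> : L `&` [set x | forall j, j \in i :: s -> U j x] =
    U i `&` (L `&` [set x | forall j, j \in s -> U j x]).
  apply/seteqP; split=> [x [Lx Ux]|x [Ux [Lx Us]]].
    split; first exact/Ux/mem_head.
    by split=> // j js; apply: Ux; rewrite inE js orbT.
  by split=> // j; rewrite inE => /orP[/eqP->|/Us].
by split; [exact: subgroupI|exact: finite_indexI].
Qed.

(** The core is cut out by the conjugates of [U] by finitely many coset
    representatives, each of them of finite index. *)
Lemma finite_index_core U G : subgroup G -> subgroup U -> finite_index U G ->
  exists K, [/\ normal_in K G, finite_index K G & K `<=` U].
Proof.
move=> sG sU fU; have [s sGs sP] := finite_index_reps sU fU.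
have conjP t : t \in s ->
    subgroup [set x | U (x ^ t)] /\ finite_index [set x | U (x ^ t)] G.
  move=> ts; have sUt : subgroup [set x | U (x ^ t)].
    split=> [|x y /= Ux Uy]; first by rewrite /= conj1g; case: sU.
    by rewrite conjMg conjVg; case: sU => _; apply.
  split=> //; have /(finite_indexP _ sU)[I [f [ff fH]]] := fU.
  apply/finite_indexP => //; exists I, (fun x => f (x ^ t)); split.
    apply: sub_finite_set ff => _ [x Gx <-]; exists (x ^ t) => //.
    by apply: subgroupJ => //; apply: sGs.
  move=> x y Gx Gy E; rewrite /= conjMg conjVg.
  by apply: fH => //; apply: subgroupJ => //; apply: sGs.
have [sK fK] := finite_index_bigI sG conjP.
have KP x g : (G `&` [set x | forall t, t \in s -> U (x ^ t)]) x -> G g -> U (x ^ g).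
  move=> [Gx Ux] Gg; have [t ts Ut] := sP g Gg.
  rewrite -(mulVKg t g) conjgM; apply: subgroupJ => //; exact: Ux.
exists (G `&` [set x | forall t, t \in s -> U (x ^ t)]); split=> //.
  split; first by split=> // x [].
  move=> x h Kx Gh; split; first by apply: subgroupJ => //; case: Kx.
  by move=> t ts; rewrite -conjgM; apply: KP => //; apply: subgroupM => //; apply: sGs.
by move=> x Kx; rewrite -(conjg1 x); apply: KP => //; case: sG.
Qed.

(** Schreier's argument: if [Y] is the set of Schreier generators, the elements
    [x] of [G] such that [x * t] lies in [gen Y] for some representative [t] are
    stable under right multiplication by the generators of [G], hence exhaust
    [G]; for [x] in [H] such a [t] lies in [H] as well. *)
Lemma fin_gen_finite_index H G : subgroup G -> fin_gen G ->
  subgroup_of H G -> finite_index H G -> fin_gen H.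
Proof.
move=> sG /(fin_genP sG)[s sGs Gs] [sH HG] fH.
have [r rG rP] := finite_index_reps sH fH.
pose s' := s ++ [seq x^-1 | x <- s].
(* The inverses of left coset representatives represent the right cosets.  They
   join the Schreier generators because the representative of H need not be 1. *)
pose c := [seq x^-1 | x <- r] ++
  [seq x * u | x <- [seq t^-1 * x | t <- r, x <- s'], u <- r].
pose Y := [seq x <- c | `[< H x >]].
have YH : [set` Y] `<=` H by move=> x /=; rewrite mem_filter => /andP[/asboolP].
have sY := gen_subgroup [set` Y].
have YP x : H x -> x \in c -> gen [set` Y] x.
  by move=> Hx xc; apply: sub_gen => /=; rewrite mem_filter xc andbT; apply/asboolP.
apply/fin_genP => //; exists Y => // h Hh.
pose W := [set x : gT | exists2 t, t \in r & gen [set` Y] (x * t)].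
have WM x y : y \in s' -> G x -> W x -> W (x * y).
  move=> ys Gx [t tr xt].
  have Gt : G t by apply: rG.
  have Gy : G y.
    move: ys; rewrite mem_cat => /orP[|/mapP[z zs ->]]; first exact: sGs.
    by apply: subgroupV => //; apply: sGs.
  have [u ur Hu] : exists2 u, u \in r & H (u^-1 * (y^-1 * t)).
    by apply: rP; apply: subgroupM => //; apply: subgroupV.
  exists u => //; have -> : x * y * u = x * t * (t^-1 * y * u) by group_word.
  apply: (subgroupM sY xt); apply: YP.
    by have := subgroupV sH Hu; group_word.
  by rewrite mem_cat; apply/orP; right; do 2!apply: allpairs_f => //.
have W1 : W 1.
  have [t tr Ht] := rP 1 sG.1; exists t; rewrite // mul1g -[t]invgK.
  apply: (subgroupV sY); apply: YP; first by move: Ht; rewrite mulg1.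
  by rewrite mem_cat map_f.
have /(_ h (Gs h (HG h Hh)))[_ hW] : gen [set` s] `<=` G `&` [set y |
    forall x, G x -> W x -> W (x * y) /\ W (x * y^-1)].
  apply: gen_sub => [|y /= ys].
    split=> [|y z [Gy yW] [Gz zW]].
      by split; [case: sG|move=> x _ Wx; rewrite invg1 mulg1].
    split=> [|x Gx Wx]; first by case: sG => _; apply.
    have [Wxz WxVz] := zW x Gx Wx; have [Wxy WxVy] := yW x Gx Wx; split.
      rewrite mulgA.
      by case: (zW _ (subgroupM sG Gx Gy) Wxy).
    rewrite invgM invgK mulgA.
    by case: (yW _ (subgroupM sG Gx Gz) Wxz).
  split=> [|x Gx Wx]; first exact: sGs.
  by split; apply: WM => //; rewrite mem_cat ?ys ?map_f ?orbT.
have [] := hW 1 sG.1 W1; rewrite mul1g => -[t tr Yht] _.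
have Ht : H t by apply: (subgroupMl sH Hh); exact: (gen_sub sH YH).
apply: (subgroupMr sY _ Yht); rewrite -[t]invgK; apply: (subgroupV sY).
apply: YP; first exact: subgroupV.
by rewrite mem_cat map_f.
Qed.


Lemma fin_gen_supergroup H L : subgroup L -> subgroup_of H L ->
  finite_index H L -> fin_gen H -> fin_gen L.
Proof.
move=> sL [sH HL] fH /(fin_genP sH)[s sS Hs].
have [r rL rP] := finite_index_reps sH fH.
have sG := gen_subgroup [set` r ++ s].
apply/(fin_genP sL); exists (r ++ s) => [x /=|x Lx].
  by rewrite mem_cat => /orP[/rL//|/sS/HL].
have [t tr Ht] := rP x Lx; rewrite -(mulVKg t x); apply: (subgroupM sG).
  by apply: sub_gen; rewrite /= mem_cat tr.
by apply: (genS _ (Hs _ Ht)) => y /= ys; rewrite mem_cat ys orbT.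
Qed.

Lemma infinite_pigeonhole (I J : Type) (A : set I) (f : I -> J) :
  infinite_set A -> finite_set (f @` A) ->
  exists x y : I, [/\ A x, A y, x <> y & f x = f y].
Proof.
move=> iA ff; apply: contrapT => nE; apply: iA.
have finj : {in A &, injective f}.
  move=> x y /set_mem Ax /set_mem Ay E; apply: contrapT => xy; apply: nE.
  by exists x, y.
by rewrite (eq_finite_set (card_esym (inj_card_eq finj))).
Qed.

(** Two distinct elements of [R] lie in the same coset of [M]. *)
Lemma infinite_meet_finite_index M R L : subgroup M -> subgroup R -> R `<=` L ->
  infinite_set R -> finite_index M L -> exists x, [/\ R x, M x & x <> 1].
Proof.
move=> sM sR RL iR /(finite_indexP _ sM)[I [f [ff fM]]].
have [|x [y [Rx Ry xy E]]] := infinite_pigeonhole (f := f) iR.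
  by apply: sub_finite_set ff; apply: image_subset.
exists (x^-1 * y); split; last by move=> /mulg1_eq; rewrite invgK.
  by apply: subgroupM => //; apply: subgroupV.
by apply: fM => //; apply: RL.
Qed.

Lemma finite_index_power M L x : subgroup M -> subgroup L -> finite_index M L ->
  L x -> exists2 k, (0 < k)%N & M (x ^+ k).
Proof.
move=> sM sL /(finite_indexP _ sM)[I [f [ff fM]]] Lx.
have [|i [j [_ _ ij E]]] := infinite_pigeonhole (f := fun n => f (x ^+ n)) infinite_nat.
  apply: sub_finite_set ff => _ [n _ <-]; exists (x ^+ n) => //.
  exact: subgroupX.
wlog lij : i j ij E / (i < j)%N.
  move=> W; have /eqP := ij; rewrite neq_ltn => /orP[|] lij; first exact: (W i j).
  by apply: (W j i) => // /esym.
exists (j - i)%N; first by rewrite subn_gt0.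
have -> : x ^+ (j - i) = (x ^+ i)^-1 * x ^+ j.
  by rewrite -[in RHS](subnKC (ltnW lij)) expgnDr mulKg.
by apply: fM => //; apply: subgroupX.
Qed.

(** * Torsion *)

Definition torsion x := exists2 k, (0 < k)%N & x ^+ k = 1.

Definition virtually_abelian H := exists M, [/\ subgroup_of M H,
  finite_index M H & forall x y, M x -> M y -> x * y = y * x].

Lemma torsionX x k : (0 < k)%N -> torsion (x ^+ k) -> torsion x.
Proof. by move=> k0 [m m0 E]; exists (k * m)%N; rewrite ?muln_gt0 ?k0// expgnA. Qed.

Lemma torsionV x : torsion x -> exists k, x^-1 = x ^+ k.
Proof.
move=> [[//|k] _ E]; exists k; apply: mulg1_eq.
by rewrite -expgS.
Qed.

Lemma virtually_abelian_gen1 x : virtually_abelian (gen [set x]).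
Proof.
exists (gen [set x]); have sx := gen_subgroup [set x]; split.
- by split.
- exact: finite_index_refl.
- move=> y z xy xz; apply/commgP/eqP.
  apply: (@gen_commutators [set 1] [set x]) => //; first exact: subgroup1.
    by move=> _ h ->; rewrite conj1g.
  by move=> _ _ -> ->; rewrite commgg.
Qed.

Lemma virtually_abelianS H L : subgroup H -> H `<=` L ->
  virtually_abelian L -> virtually_abelian H.
Proof.
move=> sH HL [M [[sM ML] fM cM]]; exists (M `&` H); split.
- by split; [apply: subgroupI|apply: subIsetr].
- exact: finite_index_trace fM.
- by move=> x y [Mx _] [My _]; apply: cM.
Qed.

(** The subgroup [M'] is [<s> M]; that [M] contains the commutators of [R] makes
    it a group. *)
Lemma finite_index_cyclic_extension M s R : subgroup R -> subgroup_of M R ->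
  (forall x y, R x -> R y -> M [~ x, y]) -> R s -> torsion s ->
  exists M', [/\ subgroup_of M' R, M `<=` M', M' s & finite_index M M'].
Proof.
move=> sR [sM MR] RM Rs ts; have [k sk] := torsionV ts.
pose M' := [set x | R x /\ exists i, M ((s ^+ i)^-1 * x)].
have sM' : subgroup M'.
  split=> [|x y [Rx [i Mx]] [Ry [j My]]].
    by split; [case: sR|exists 0%N; rewrite expg0 invg1 mulg1; case: sM].
  split; first by case: sR => _; apply.
  have jk : (s ^+ j)^-1 = s ^+ (k * j) by rewrite -expVgn sk expgnA.
  exists (i + k * j)%N; rewrite expgnDr -jk.
  set a := s ^+ i in Mx *; set b := s ^+ j in My *.
  have Ra : R a by apply: subgroupX.
  have Rb : R b by apply: subgroupX.
  have Rax : R (a^-1 * x) by apply: MR.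
  have Rby : R (b^-1 * y) by apply: MR.
  (* With x in a M and y in b M, the M-part of x / y is p up to the commutator
     that appears when b^-1 is moved past p. *)
  pose p := (a^-1 * x) * (b^-1 * y)^-1.
  have Mp : M p by apply: subgroupM => //; apply: subgroupV.
  have -> : (a * b^-1)^-1 * (x * y^-1) = p * [~ p, b^-1] by rewrite /p; group_word.
  by apply: subgroupM => //; apply: RM; [apply: MR|apply: subgroupV].
exists M'; split.
- by split=> // x [].
- move=> x Mx; split; first exact: MR.
  by exists 0%N; rewrite expg0 invg1 mul1g.
- by split=> //; exists 1%N; rewrite expg1 mulVg; case: sM.
case: ts => m m0 E; apply: (@finite_index_of_reps _ _ [seq s ^+ i | i <- iota 0 m]) => //.
move=> x [Rx [i Mx]]; exists (s ^+ (i %% m)).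
  by apply: map_f; rewrite mem_iota ltn_mod.
by move: Mx; rewrite {1}(divn_eq i m) mulnC expgnDr expgnA E expg1n mul1g.
Qed.

(** A finitely generated torsion abelian group, here [R / N], is finite: the
    generators are adjoined to [N] one at a time. *)
Lemma finite_index_torsion_abelian N R : subgroup R -> fin_gen R ->
  subgroup_of N R -> (forall x y, R x -> R y -> N [~ x, y]) ->
  (forall x, R x -> torsion x) -> finite_index N R.
Proof.
move=> sR /(fin_genP sR)[s sS Rs] [sN NR] RN tR.
suff [M [[sM MR] NM sM' fM]] : exists M, [/\ subgroup_of M R, N `<=` M,
    [set` s] `<=` M & finite_index N M].
  by apply: (finite_indexS sN sN _ _ fM) => // x /Rs; apply: gen_sub.
elim: s sS {Rs} => [|x s IH] sS.
  by exists N; split=> //; apply: finite_index_refl.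
have [|M [[sM MR] NM sM' fM]] := IH.
  by move=> y ys; apply: sS; rewrite /= inE ys orbT.
have Rx : R x by apply: sS; rewrite /= mem_head.
have [||M' [sM'' MM' M'x fM']] :=
    @finite_index_cyclic_extension M x R sR _ _ Rx (tR x Rx) => //.
  by move=> u v Ru Rv; apply/NM/RN.
exists M'; split=> //; first by move=> u /NM/MM'.
- by move=> u /=; rewrite inE => /orP[/eqP->//|/sM'/MM'].
- exact: finite_index_trans fM fM'.
Qed.

(** * Closed subsets *)

Definition open_subgroup K U := subgroup_of U K /\ finite_index U K.

Lemma open_subgroup_refl K : subgroup K -> open_subgroup K K.
Proof. by move=> sK; split; [split|apply: finite_index_refl]. Qed.

Lemma open_subgroupI K U V :
  open_subgroup K U -> open_subgroup K V -> open_subgroup K (U `&` V).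
Proof.
move=> [[sU UK] fU] [[sV VK] fV]; split; last exact: finite_indexI.
by split; [apply: subgroupI|move=> x [/UK]].
Qed.

Lemma open_subgroup_all (I : eqType) (s : seq I) (P : I -> gT -> Prop) K :
  subgroup K ->
  (forall i, i \in s -> exists2 U, open_subgroup K U & forall u, U u -> P i u) ->
  exists2 U, open_subgroup K U & forall i u, i \in s -> U u -> P i u.
Proof.
move=> sK; elim: s => [|i s IH] sP; first by exists K => //; apply: open_subgroup_refl.
have [U oU UP] := sP i (mem_head _ _).
have [|V oV VP] := IH; first by move=> j js; apply: sP; rewrite inE js orbT.
exists (U `&` V); first exact: open_subgroupI.
by move=> j u; rewrite inE => /orP[/eqP-> [/UP]|js [_ /VP]]//; apply.
Qed.

(** The finite index subgroups, normal or not, define the same topology, since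
    they contain normal ones of finite index. *)
Lemma profinite_closedP K A : subgroup K -> A `<=` K ->
  profinite_closed K A <-> forall g, K g -> ~ A g ->
    exists2 U, open_subgroup K U & forall u, U u -> ~ A (g * u).
Proof.
move=> sK AK; split=> [[_ [_ cA]] g Kg nAg|cA].
  have [|U [nU fU UA]] := cA g; first by split.
  exists U; first by split=> //; case: nU.
  by move=> u Uu; have [] : (K `\` A) (g * u) by apply: UA; exists u.
split=> //; split=> [x []//|g [Kg nAg]].
have [U [[sU UK] fU] UA] := cA g Kg nAg.
have [V [nV fV VU]] := finite_index_core sK sU fU.
exists V; split=> // _ [v Vv <-]; split; last exact/UA/VU.
by apply: subgroupM => //; apply/UK/VU.
Qed.

Lemma closed_open_subgroup K N : subgroup K -> open_subgroup K N ->
  profinite_closed K N.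
Proof.
move=> sK oN; have [[sN NK] fN] := oN.
apply/profinite_closedP => // g Kg nNg; exists N => // u Nu Ngu; apply: nNg.
exact: subgroupMr Ngu.
Qed.

(** [N] is a finite union of translates of [M]. *)
Lemma closed_supergroup K M N : subgroup K -> subgroup_of M N ->
  subgroup_of N K -> finite_index M N ->
  profinite_closed K M -> profinite_closed K N.
Proof.
move=> sK [sM MN] [sN NK] fM cM.
have [r rN rP] := finite_index_reps sM fM.
have MK : M `<=` K by move=> x /MN/NK.
apply/profinite_closedP => // g Kg nNg.
have [|U oU UP] := @open_subgroup_all _ r (fun t u => ~ M (t^-1 * g * u)) K sK.
  move=> t tr; apply: ((profinite_closedP sK MK).1 cM).
    by apply: subgroupM => //; apply: subgroupV => //; apply/NK/rN.
  move=> /MN Ntg; apply: nNg; apply: (subgroupMl sN _ Ntg).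
  by apply: subgroupV => //; apply: rN.
exists U => // u Uu /rP[t tr]; rewrite mulgA; exact: UP.
Qed.

Lemma closed_trans G K A : subgroup G -> open_subgroup G K ->
  profinite_closed K A -> profinite_closed G A.
Proof.
move=> sG oK cA; have [[sK KG] fK] := oK; have [AK _] := cA.
have AG : A `<=` G by move=> x /AK/KG.
apply/profinite_closedP => // g Gg nAg.
have [Kg|nKg] := pselect (K g).
  have [U [[sU UK] fU] UA] := (profinite_closedP sK AK).1 cA g Kg nAg.
  exists U => //; split; last exact: finite_index_trans fU fK.
  by split=> // x /UK/KG.
exists K => // u Ku /AK Kgu; apply: nKg; exact: subgroupMr Kgu.
Qed.

(** * Normal subgroups modulo intersections *)

Definition mulset N A := [set g : gT | exists2 n, N n & A (n^-1 * g)].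

Lemma mulsetM N A n a : N n -> A a -> mulset N A (n * a).
Proof. by move=> Nn Aa; exists n; rewrite ?mulKg. Qed.

Lemma mulsetS N M A B : N `<=` M -> A `<=` B -> mulset N A `<=` mulset M B.
Proof. by move=> NM AB x [n /NM Mn /AB Bx]; exists n. Qed.

Lemma sub_mulsetl N A : subgroup A -> N `<=` mulset N A.
Proof. by move=> [A1 _] x Nx; rewrite -[x]mulg1; apply: mulsetM. Qed.

Lemma sub_mulsetr N A : subgroup N -> A `<=` mulset N A.
Proof. by move=> [N1 _] x Ax; rewrite -[x]mul1g; apply: mulsetM. Qed.

Lemma mulset_subgroup N A : subgroup N -> subgroup A ->
  (forall a n, A a -> N n -> A (a ^ n)) -> subgroup (mulset N A).
Proof.
move=> sN sA nA; split=> [|x y [n Nn Ax] [m Nm Ay]].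
  by rewrite -[1]mulg1; apply: mulsetM; [case: sN|case: sA].
exists (n * m^-1); first by case: sN => _; apply.
have -> : (n * m^-1)^-1 * (x * y^-1) = (n^-1 * x * (m^-1 * y)^-1) ^ m^-1.
  by group_word.
apply: nA; last exact: subgroupV.
by apply: subgroupM => //; apply: subgroupV.
Qed.

Lemma mulsetJ N A H :
  (forall x h, N x -> H h -> N (x ^ h)) -> (forall x h, A x -> H h -> A (x ^ h)) ->
  forall x h, mulset N A x -> H h -> mulset N A (x ^ h).
Proof.
move=> nN nA x h [n Nn An] Hh; exists (n ^ h); first exact: nN.
by rewrite -conjVg -conjMg; apply: nA.
Qed.

Lemma mulset_sub N A K : subgroup K -> N `<=` K -> A `<=` K -> mulset N A `<=` K.
Proof.
move=> sK NK AK x [n /NK Kn /AK Ka].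
by rewrite -(mulVKg n x); apply: subgroupM.
Qed.

Lemma normal_meet N A H K : normal_in N H -> normal_in A K -> H `<=` K ->
  normal_in (N `&` A) H.
Proof.
move=> [[sN NH] nN] [[sA AK] nA] HK; split.
  by split; [apply: subgroupI|move=> x [/NH]].
by move=> x h [Nx Ax] Hh; split; [apply: nN|apply/nA/HK].
Qed.

(** [N] modulo [A `&` B] is an extension of [N] modulo [A] by [N `&` A] modulo [B],
    and [N `&` A] is again normal in [H]. *)
Lemma fin_gen_mod_meet K H A B : H `<=` K -> normal_in A K ->
  (forall N, normal_in N H -> exists2 s : seq gT, [set` s] `<=` N &
     N `<=` mulset (gen [set` s]) A) ->
  (forall N, normal_in N H -> exists2 s : seq gT, [set` s] `<=` N &
     N `<=` mulset (gen [set` s]) B) ->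
  forall N, normal_in N H -> exists2 s : seq gT, [set` s] `<=` N &
     N `<=` mulset (gen [set` s]) (A `&` B).
Proof.
move=> HK nA HA HB N nN; have [[sN NH] _] := nN; have [[sA AK] _] := nA.
have [s sSN Ns] := HA N nN; have [t tSN Nt] := HB _ (normal_meet nN nA HK).
have tNA : gen [set` t] `<=` N `&` A.
  by apply: gen_sub => //; apply: subgroupI.
exists (s ++ t) => [x /=|n Nn].
  by rewrite mem_cat => /orP[/sSN//|/tSN[]].
have [x sx Axn] := Ns n Nn.
have Nx : N x by apply: (gen_sub sN sSN).
have [|y ty Byxn] := Nt (x^-1 * n).
  by split=> //; apply: subgroupM => //; apply: subgroupV.
exists (x * y).
  apply: (subgroupM (gen_subgroup _)); [move: x sx {Axn Nx Byxn}|move: y ty {Byxn}].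
    by apply: genS => z /= zs; rewrite mem_cat zs.
  by apply: genS => z /= zs; rewrite mem_cat zs orbT.
rewrite invgM -mulgA; split=> //; apply: subgroupM => //; apply: subgroupV => //.
by case: (tNA y ty).
Qed.

(** For [A] and [B] the kernels of two maps, this says that a subdirect product is
    closed if enough subgroups of its factors are.  Let [g] be outside
    [N (A `&` B)].  If [g] is outside [N A], there is nothing to do; otherwise one
    may translate by [N] and replace [g] by some [a] in [A].  Then [a] is outside
    [L2 B], where [L2 = N `&` A] is normal in [H], hence outside [D = L2 B V] for
    some open normal [V].  The group [L1 = N `&` D] is normal in [H] and of
    finite index in [N]; therefore [L1 A] is closed and of finite index in [N A],
    so that some open [U] satisfies [U `&` N A `<=` L1 A].  Now [U `&` V] does the
    job: if [a * u = k * c] with [k] in [N], [c] in [A `&` B] and [u] in [U `&` V],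
    the first coordinate shows that [u], hence [k], lies in [L1 A], so [k] lies in
    [L1 (N `&` A)], which is contained in [D], and then [a] lies in [D], a
    contradiction. *)
Lemma closed_mod_meet K H A B : subgroup K -> subgroup_of H K ->
  normal_in A K -> normal_in B K ->
  (forall N, normal_in N H -> profinite_closed K (mulset N A)) ->
  (forall N, normal_in N H -> profinite_closed K (mulset N B)) ->
  forall N, normal_in N H -> profinite_closed K (mulset N (A `&` B)).
Proof.
move=> sK [sH HK] nA nB cA cB N nN.
have [[sA AK] jA] := nA; have [[sB BK] jB] := nB; have [[sN NH] jN] := nN.
have NK : N `<=` K by move=> x /NH/HK.
have NABK : mulset N (A `&` B) `<=` K.
  by apply: mulset_sub => // x [/AK].
apply/profinite_closedP => // g Kg nNg.
have NAK : mulset N A `<=` K by apply: mulset_sub.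
have [[n Nn Aa]|nNAg] := pselect (mulset N A g); last first.
  have [U oU UP] := (profinite_closedP sK NAK).1 (cA N nN) g Kg nNAg.
  exists U => // u /UP nu NABgu; apply: nu.
  by apply: mulsetS NABgu => // x [].
set a := n^-1 * g in Aa.
have nL2 := normal_meet nN nA HK; set L2 := N `&` A in nL2.
have [[sL2 L2H] jL2] := nL2.
have L2K : L2 `<=` K by move=> x /L2H/HK.
have nL2Ba : ~ mulset L2 B a.
  move=> [l [Nl Al] Bla]; apply: nNg; exists (n * l); first exact: subgroupM.
  rewrite invgM -mulgA; split=> //.
  by apply: subgroupM => //; apply: subgroupV.
have sL2B : subgroup (mulset L2 B).
  by apply: mulset_subgroup => // x h Bx Lh; apply: jB => //; apply: L2K.
have L2BK : mulset L2 B `<=` K by apply: mulset_sub.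
have [_ [_ /(_ a)[|V [nV fV aV]]]] := cB _ nL2.
  by split=> //; apply: AK.
have [[sV VK] jV] := nV.
pose D := mulset (mulset L2 B) V.
have sD : subgroup D.
  by apply: mulset_subgroup => // x h Vx Lh; apply: jV => //; apply: L2BK.
have VD : V `<=` D by apply: sub_mulsetr.
have L2BD : mulset L2 B `<=` D by apply: sub_mulsetl.
have BD : B `<=` D by move=> x Bx; apply/L2BD/sub_mulsetr.
have L2D : L2 `<=` D by move=> x Lx; apply/L2BD/sub_mulsetl.
have nDa : ~ D a.
  move=> [l Ll Vla]; have [_] : (K `\` mulset L2 B) (a * (l^-1 * a)^-1).
    by apply: aV; exists (l^-1 * a)^-1 => //; apply: subgroupV.
  have -> : a * (l^-1 * a)^-1 = l by group_word.
  by apply.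
have DJ x h : D x -> H h -> D (x ^ h).
  move: x h; apply: mulsetJ => [|x h Vx /HK]; last exact: jV.
  by apply: mulsetJ => // x h Bx /HK; apply: jB.
have fD : finite_index D K by apply: (finite_indexS sV sD _ _ fV).
pose L1 := D `&` N.
have sL1 : subgroup L1 by apply: subgroupI.
have fL1 : finite_index L1 N by apply: finite_index_trace fD.
have nL1 : normal_in L1 H.
  split; first by split=> // x [_ /NH].
  by move=> x h [Dx Nx] Hh; split; [apply: DJ|apply: jN].
have L1K : L1 `<=` K by move=> x [_ /NK].
have sL1A : subgroup (mulset L1 A).
  by apply: mulset_subgroup => // x h Ax Lh; apply: jA => //; apply: L1K.
have L1AK : mulset L1 A `<=` K by apply: mulset_sub.
have AL1A : A `<=` mulset L1 A by apply: sub_mulsetr.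
have [r rN rP] := finite_index_reps sL1 fL1.
(* U must avoid the finitely many cosets of L1 A in N A other than L1 A. *)
have [|U oU UP] := @open_subgroup_all _ r
    (fun t u => mulset L1 A (t^-1 * u) -> mulset L1 A t^-1) K sK.
  move=> t tr; have [Lt|nLt] := pselect (mulset L1 A t^-1).
    by exists K => //; apply: open_subgroup_refl.
  have [|U oU UP] := (profinite_closedP sK L1AK).1 (cA _ nL1) t^-1 _ nLt.
    by apply: subgroupV => //; apply/NK/rN.
  by exists U => // u /UP.
exists (U `&` V); first by apply: open_subgroupI.
move=> u [Uu Vu] [m Nm [Ac Bc]]; set c := m^-1 * (g * u) in Ac Bc.
pose k := n^-1 * m.
have Nk : N k by apply: subgroupM => //; apply: subgroupV.
(* With a in A normal, u = a^-1 k c is rewritten as an element of N times an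
   element of A. *)
have uE : u = k * ((a^-1) ^ k * c) by rewrite /k /c /a; group_word.
have Aac : A ((a^-1) ^ k * c).
  apply: subgroupM => //; apply: jA; [exact: subgroupV|exact: NK].
have L1u : mulset L1 A u.
  have [t tr Lt] := rP k Nk.
  have Ltu : mulset L1 A (t^-1 * u).
    by rewrite uE mulgA; apply: mulsetM.
  exact: (subgroupMl sL1A (UP t u tr Uu Ltu) Ltu).
have kE : k = a * u * c^-1 by rewrite /k /c /a; group_word.
have [l [Dl Nl] Alk] : mulset L1 A k.
  rewrite kE; apply: subgroupM => //; first by apply: subgroupM => //; apply: AL1A.
  by apply: AL1A; apply: subgroupV.
have Dk : D k.
  rewrite -(mulVKg l k); apply: subgroupM => //; apply: L2D; split=> //.
  by apply: subgroupM => //; apply: subgroupV.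
apply: nDa; have -> : a = k * c * u^-1 by rewrite kE; group_word.
apply: subgroupM => //; first by apply: subgroupM => //; apply: BD.
by apply: subgroupV => //; apply: VD.
Qed.

End Groups.

(** * Homomorphisms defined on a subgroup *)

Section Morphisms.
Variables (gT rT : groupType) (K : set gT) (f : gT -> rT).
Hypotheses (sK : subgroup K)
  (fM : forall x y, K x -> K y -> f (x * y) = f x * f y).
Implicit Types (H N M : set gT) (x y : gT).

Lemma morph1 : f 1 = 1.
Proof.
have K1 : K 1 by case: sK.
by apply: (mulgI (f 1)); rewrite -fM// !mulg1.
Qed.

Lemma morphV x : K x -> f x^-1 = (f x)^-1.
Proof.
move=> Kx; have KVx : K x^-1 by apply: subgroupV.
by apply/esym/mulg1_eq; rewrite -fM// mulgV morph1.
Qed.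

Lemma morphX x n : K x -> f (x ^+ n) = f x ^+ n.
Proof.
move=> Kx; elim: n => [|n IH]; first exact: morph1.
by rewrite !expgS fM ?IH//; apply: subgroupX.
Qed.

Lemma image_subgroup H : subgroup H -> H `<=` K -> subgroup (f @` H).
Proof.
move=> sH HK; split; first by exists 1; [case: sH|exact: morph1].
move=> _ _ [x Hx <-] [y Hy <-]; exists (x * y^-1); first by case: sH => _; apply.
have [Kx Ky] := (HK x Hx, HK y Hy).
by rewrite fM ?morphV//; apply: subgroupV.
Qed.

Lemma image_normal N H : normal_in N H -> subgroup_of H K ->
  normal_in (f @` N) (f @` H).
Proof.
move=> [[sN NH] nN] [sH HK]; split.
  split; last exact: image_subset.
  by apply: image_subgroup => // x /NH/HK.
move=> _ _ [x Nx <-] [h Hh <-]; exists (x ^ h); first exact: nN.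
have Kh := HK h Hh; have Kx := HK x (NH x Nx).
rewrite !conjgE !fM ?morphV//; [exact: subgroupV|exact: subgroupM].
Qed.

Lemma finite_index_image M H : subgroup_of M H -> subgroup_of H K ->
  finite_index M H -> finite_index (f @` M) (f @` H).
Proof.
move=> [sM MH] [sH HK] /(finite_index_reps sM)[s sHs sP].
apply: (@finite_index_of_reps _ _ _ [seq f x | x <- s]).
  by apply: image_subgroup => // x /MH/HK.
move=> _ [x Hx <-]; have [t ts Mt] := sP x Hx.
exists (f t); first exact: map_f.
have Kt : K t by apply/HK/sHs.
by exists (t^-1 * x) => //; rewrite fM ?morphV//; [apply: subgroupV|apply: HK].
Qed.

Lemma virtually_abelian_image H : subgroup_of H K ->
  virtually_abelian H -> virtually_abelian (f @` H).
Proof.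
move=> sHK [M [[sM MH] iM cM]]; have [sH HK] := sHK; exists (f @` M); split.
- split; last exact: image_subset.
  by apply: image_subgroup => // x /MH/HK.
- exact: finite_index_image.
- move=> _ _ [x Mx <-] [y My <-].
  have [Kx Ky] := (HK x (MH x Mx), HK y (MH y My)).
  by rewrite -!fM// cM.
Qed.

Definition kernel := [set x | K x /\ f x = 1].

Lemma kernel_normal : normal_in kernel K.
Proof.
have sk : subgroup kernel.
  split=> [|x y [Kx fx] [Ky fy]]; first by split; [case: sK|exact: morph1].
  split; first by case: sK => _; apply.
  by rewrite fM ?morphV// ?fx ?fy ?invg1 ?mulg1//; apply: subgroupV.
split; first by split=> // x [].
move=> x h [Kx fx] Kh; split; first exact: subgroupJ.
have KVh : K h^-1 by apply: subgroupV.
by rewrite conjgE !fM ?fx ?mul1g ?morphV ?mulVg//; apply: subgroupM.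
Qed.

Lemma mulset_kernelP N x : subgroup N -> N `<=` K -> K x ->
  mulset N kernel x <-> (f @` N) (f x).
Proof.
move=> sN NK Kx; split=> [[n Nn [_ E]]|[n Nn E]]; exists n => //.
  have Kn := NK n Nn; apply: (mulgI (f n^-1)).
  by rewrite -!fM//; [rewrite E mulVg morph1|apply: subgroupV|apply: subgroupV].
have KVn : K n^-1 by apply: subgroupV => //; apply: NK.
split; first exact: subgroupM.
by rewrite fM// morphV ?E ?mulVg//; apply: NK.
Qed.

Lemma open_subgroup_preimage (G U : set rT) : (forall x, K x -> G (f x)) ->
  open_subgroup G U -> open_subgroup K (K `&` f @^-1` U).
Proof.
move=> fG [[sU UG] /(finite_indexP _ sU)[I [c [fc cU]]]].
have sKU : subgroup (K `&` f @^-1` U).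
  split=> [|x y [Kx Ux] [Ky Uy]].
    by split; [case: sK|rewrite /preimage /= morph1; case: sU].
  have KVy : K y^-1 by apply: subgroupV.
  split; first exact: subgroupM.
  by rewrite /preimage /= fM// morphV//; case: sU => _; apply.
split; first by split=> // x [].
apply/finite_indexP => //; exists I, (c \o f); split.
  by apply: sub_finite_set fc => _ [x Kx <-]; exists (f x) => //; apply: fG.
move=> x y Kx Ky E; have KVx : K x^-1 by apply: subgroupV.
split; first exact: subgroupM.
rewrite /preimage /= fM// morphV//.
by apply: cU => //; apply: fG.
Qed.

(** Homomorphisms are continuous for the profinite topologies. *)
Lemma closed_mod_kernel (G : set rT) N : subgroup G ->
  (forall x, K x -> G (f x)) -> subgroup_of N K ->
  profinite_closed G (f @` N) -> profinite_closed K (mulset N kernel).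
Proof.
move=> sG fG [sN NK] cN; have [fNG _] := cN.
have NkK : mulset N kernel `<=` K by apply: mulset_sub => // x [].
apply/profinite_closedP => // g Kg nNg.
have nfNg : ~ (f @` N) (f g) by move/(mulset_kernelP sN NK Kg).
have [U oU UN] := (profinite_closedP sG fNG).1 cN _ (fG g Kg) nfNg.
exists (K `&` f @^-1` U); first exact: open_subgroup_preimage oU.
move=> u [Ku Uu] /(mulset_kernelP sN NK (subgroupM sK Kg Ku)).
by rewrite fM//; apply: UN.
Qed.

Lemma fin_gen_mod_kernel N : subgroup_of N K -> fin_gen (f @` N) ->
  exists2 s : seq gT, [set` s] `<=` N & N `<=` mulset (gen [set` s]) kernel.
Proof.
move=> [sN NK] /(fin_genP (image_subgroup sN NK))[s sS Ns].
suff [t tN ts] : exists2 t : seq gT, [set` t] `<=` N & s = [seq f x | x <- t].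
  have tK : gen [set` t] `<=` K by apply: gen_sub => // x /tN/NK.
  have st := gen_subgroup [set` t].
  exists t => // n Nn; apply/mulset_kernelP => //; first exact: NK.
  have : gen [set` s] (f n) by apply: Ns; exists n.
  apply: gen_sub; first exact: image_subgroup.
  by move=> y /=; rewrite ts => /mapP[x xt ->]; exists x => //; apply: sub_gen.
elim: s sS {Ns} => [|y s IH] sS; first by exists [::].
have [|t tN ->] := IH; first by move=> z zs; apply: sS; rewrite /= inE zs orbT.
have [x Nx xy] : (f @` N) y by apply: sS; rewrite /= mem_head.
exists (x :: t); last by rewrite /= xy.
by move=> z /=; rewrite inE => /orP[/eqP->|/tN].
Qed.

End Morphisms.

(** * Automorphisms of the tree *)

Section Tree.
Variable d : nat.
Implicit Types (u v w : word d) (g h a b : aut d) (G H N R : set (aut d)).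

Lemma autME g h w : (g * h) w = g (h w). Proof. by []. Qed.

Lemma autKV g w : g^-1 (g w) = w. Proof. exact: autK. Qed.

Lemma autVKV g w : g (g^-1 w) = w. Proof. exact: autVK. Qed.

Lemma autV_fixed g w : g w = w -> g^-1 w = w.
Proof. by move=> E; rewrite -{1}E autKV. Qed.

Lemma aut_neq1 g : g <> 1 -> exists w, g w <> w.
Proof.
by move=> g1; apply: contrapT => nE; apply: g1; apply: aut_eq => w;
  apply: contrapT => gw; apply: nE; exists w.
Qed.

Lemma sectionM g h v : h v = v -> section (g * h) v = section g v * section h v.
Proof.
move=> hv; apply/esym/section_unique => w.
by rewrite !autME sectionE hv sectionE.
Qed.

(** The orbit of [w] lies in a finite level. *)
Lemma open_subgroup_fix G w : subgroup G ->
  subgroup [set g : aut d | g w = w] /\ finite_index [set g : aut d | g w = w] G.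
Proof.
move=> sG; have sF : subgroup [set g : aut d | g w = w].
  split=> // g h gw hw.
  exact: (etrans (congr1 g (autV_fixed hw)) gw).
split=> //; apply/finite_indexP => //; exists _, (fun g : aut d => g w); split.
  apply: (@sub_finite_set _ _ [set (val t : word d) | t in [set: (size w).-tuple 'I_d]]).
    move=> _ [g _ <-]; have sg : size (g w) == size w by rewrite size_aut.
    by exists (Tuple sg).
  by apply: finite_image; apply: finite_finset.
move=> g h _ _ E; have : g^-1 (h w) = w by rewrite -E autKV.
by [].
Qed.

Lemma level1P v : level 1 v <-> v \in [seq [:: i] | i <- enum 'I_d].
Proof.
split=> [|/mapP[i _ ->]//]; case: v => [//|i [|//]] _.
by apply: map_f; rewrite mem_enum.
Qed.

Lemma open_subgroup_stab1 G : subgroup G -> open_subgroup G (stab G (level 1)).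
Proof.
move=> sG; have -> : stab G (level 1) =
    G `&` [set g : aut d | forall v, v \in [seq [:: i] | i <- enum 'I_d] -> g v = v].
  by apply/seteqP; split=> g [Gg gP]; split=> // v /level1P; apply: gP.
have [|sS fS] := @finite_index_bigI _ _ [seq [:: i] | i <- enum 'I_d]
  (fun v => [set g : aut d | g v = v]) G sG.
  by move=> v _; apply: open_subgroup_fix.
by split=> //; split=> // x [].
Qed.

Lemma stab1_section_eq1 G g : stab G (level 1) g ->
  (forall v, level 1 v -> section g v = 1) -> g = 1.
Proof.
move=> [_ gP] g1; apply: aut_eq => -[|i w]; first exact: aut_root.
by rewrite -cat1s sectionE gP// g1.
Qed.

Lemma closed_set1 G : subgroup G -> profinite_closed G [set 1].
Proof.
move=> sG; apply/profinite_closedP => //; first by move=> _ ->; case: sG.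
move=> g Gg /aut_neq1[w gw].
have [sF fF] := open_subgroup_fix w sG.
exists ([set x : aut d | x w = w] `&` G).
  split; first by split; [apply: subgroupI|move=> x []].
  exact: finite_index_trace fF.
by move=> x [/= xw Gx] gx1; apply: gw; rewrite -{1}xw -autME gx1.
Qed.

(** * Rigid stabilisers *)

Lemma rist_subgroup G v : subgroup G -> subgroup (rist G v).
Proof.
move=> sG; split=> [|g h [Gg gP] [Gh hP]]; first by split=> //; case: sG.
split; first by case: sG => _; apply.
by move=> w vw; rewrite autME autV_fixed ?gP ?hP.
Qed.

Lemma prefix_aut g v w : prefix (g v) (g w) = prefix v w.
Proof.
have H h u z : prefix u z -> prefix (h u) (h z).
  by move=> /prefixP[t ->]; rewrite sectionE prefix_prefix.
by apply/idP/idP => [/(H g^-1)|/H//]; rewrite !autKV.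
Qed.

Lemma ristJ G v g h : subgroup G -> G h -> rist G v g -> rist G (h v) (g ^ h^-1).
Proof.
move=> sG Gh [Gg gP]; split.
  by apply: subgroupJ => //; apply: subgroupV.
move=> w; rewrite -{1}(autVKV h w) prefix_aut => /gP E.
by rewrite conjgE invgK !autME E autVKV.
Qed.

Lemma rist_prefix G v g w : rist G v g -> prefix v (g w) = prefix v w.
Proof.
move=> [_ gP]; apply/idP/idP; apply: contraTT => vw.
  by rewrite gP.
by have /(can_inj (autK g)) <- := gP _ vw.
Qed.

Lemma prefix_same_size u v w : size u = size v -> prefix u w -> prefix v w -> u = v.
Proof. by rewrite !prefixE => -> /eqP<- /eqP. Qed.

(** The supports lie in disjoint subtrees. *)
Lemma rist_commute G u v a b : size u = size v -> u <> v ->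
  rist G u a -> rist G v b -> a * b = b * a.
Proof.
move=> suv uv ra rb; apply: aut_eq => w; rewrite !autME.
have [_ aP] := ra; have [_ bP] := rb.
have disj z : prefix u z -> prefix v z -> False.
  by move=> uz vz; apply/uv/prefix_same_size/vz.
have [uw|uw] := boolP (prefix u w).
  rewrite [b w]bP 1?[b (a w)]bP//; apply/negP; last exact: disj.
  by apply: disj; rewrite (rist_prefix _ ra).
rewrite [a w]aP// aP//; apply/negP => ubw.
have [vw|vw] := boolP (prefix v w); last by move: uw; rewrite -(bP _ vw) ubw.
by apply: (disj (b w)); rewrite // (rist_prefix _ rb).
Qed.

(** An abelian [M] of finite index would meet every rigid stabiliser.  If [a] in
    [M] moves [w], an element [b] of [M] with support below [w] also has
    support below [a w], as it commutes with [a]; these subtrees are disjoint. *)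
Lemma branch_not_virtually_abelian G : subgroup G ->
  (forall v, infinite_set (rist G v)) -> ~ virtually_abelian G.
Proof.
move=> sG rG [M [[sM MG] fM cM]].
have meet v : exists x, [/\ rist G v x, M x & x <> 1].
  apply: infinite_meet_finite_index fM => //; first exact: rist_subgroup.
  by move=> x [].
have [a [_ Ma /aut_neq1[w aw]]] := meet [::].
have [b [rb Mb b1]] := meet w; apply: b1; apply: aut_eq => z.
have rab : rist G (a w) b.
  suff <- : b ^ a^-1 = b by apply: ristJ => //; apply: MG.
  by rewrite conjgE invgK cM ?mulgVK//; apply: subgroupM => //; apply: subgroupV.
have [_ bP] := rb; have [_ bP'] := rab.
have [wz|/bP//] := boolP (prefix w z).
apply: bP'; apply/negP => awz; apply: aw.
by apply: prefix_same_size awz wz; rewrite size_aut.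
Qed.

Lemma stab1_sectionM G v : level 1 v -> forall g h,
  stab G (level 1) g -> stab G (level 1) h ->
  section (g * h) v = section g v * section h v.
Proof. by move=> lv g h _ [_ hP]; apply: sectionM; apply: hP. Qed.

Lemma stab1_subgroup G : subgroup G -> subgroup (stab G (level 1)).
Proof. by move=> sG; have [[]] := open_subgroup_stab1 sG. Qed.

Lemma torsion_of_sections G g : subgroup G -> stab G (level 1) g ->
  (forall v, level 1 v -> torsion (section g v)) -> torsion g.
Proof.
move=> sG Sg tg; have sS := stab1_subgroup sG.
suff [k k0 kP] : exists2 k, (0 < k)%N &
    forall v, v \in [seq [:: i] | i <- enum 'I_d] -> (section g v) ^+ k = 1.
  exists k => //; apply: (@stab1_section_eq1 G); first exact: subgroupX.
  move=> v lv; rewrite (morphX sS (stab1_sectionM lv) k Sg).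
  by apply: kP; apply/level1P.
have : {subset [seq [:: i] | i <- enum 'I_d] <= [pred v | `[< level 1 v >]]}.
  by move=> v /level1P lv; apply/asboolP.
elim: [seq _ | _ <- _] => [|v s IH] sl; first by exists 1%N.
have [|k k0 kP] := IH; first by move=> u us; apply: sl; rewrite inE us orbT.
have [m m0 E] : torsion (section g v).
  by apply: tg; apply/asboolP; apply: sl; apply: mem_head.
exists (m * k)%N; first by rewrite muln_gt0 m0.
move=> u; rewrite inE => /orP[/eqP->|us]; first by rewrite expgnA E expg1n.
by rewrite mulnC expgnA kP// expg1n.
Qed.

(** An inductive class has to contain [G] from the start, so torsion itself cannot
    define it; weakening torsion to an implication makes the condition on [G] vacuous while
    keeping it meaningful for cyclic subgroups. *)
Lemma torsion_subgroup_induction G : subgroup G -> self_similar G ->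
  branch G -> subgroup_induction G -> forall g, G g -> torsion g.
Proof.
move=> sG ssG [_ rG _] iG g Gg.
pose X := [set H | subgroup_of H G /\
  (virtually_abelian H -> forall h, H h -> torsion h)].
have iX : inductive_class G X.
  split.
  - by move=> H [].
  - split; first by split; [exact: subgroup1|move=> _ ->; case: sG].
    by move=> _ _ ->; exists 1%N.
  - by split; [split|move=> /(branch_not_virtually_abelian sG rG)].
  - move=> H L [sL LG] [sH HL] fH [_ tH]; split=> // vL l Ll.
    have [k k0 Hk] := finite_index_power sH sL fH Ll.
    by apply: (torsionX k0); apply: tH => //; apply: virtually_abelianS vL.
  - move=> H [sH HS] _ HX; split; first by split=> // x /HS[].
    move=> vH h Hh; apply: (torsion_of_sections sG (HS h Hh)) => v lv.
    have [_] := HX v lv; apply; last by exists h.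
    exact: (virtually_abelian_image (stab1_subgroup sG) (stab1_sectionM lv)).
have sgG : gen [set g] `<=` G by apply: gen_sub => // _ ->.
have sg := gen_subgroup [set g].
have [|_] := iG X iX (gen [set g]) (conj sg sgG).
  by exists [set g] => //; apply: finite_set1.
by apply; [exact: virtually_abelian_gen1|exact: sub_gen].
Qed.

(** Modulo [N], [a] equals its conjugate by [g], which commutes with [b] because
    its support lies in a disjoint subtree. *)
Lemma rist_commutator G N g w a b : subgroup G -> normal_in N G -> N g ->
  g w <> w -> rist G w a -> rist G w b -> N [~ a, b].
Proof.
move=> sG [[sN NG] nN] Ng gw ra rb.
have Gg := NG g Ng.
pose x := (a^-1) ^ g.
have rx : rist G (g^-1 w) x.
  rewrite /x -[g in _ ^ g]invgK; apply: ristJ => //; first exact: subgroupV.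
  by apply: (subgroupV (rist_subgroup w sG)).
have xE y : rist G w y -> y ^ x = y.
  move=> ry; apply/conjg_fixP/commgP.
  apply: (rist_commute _ _ ry rx); first by rewrite size_aut.
  by move=> E; apply: gw; rewrite {1}E autVKV.
have -> : [~ a, b] = [~ a * x, b].
  have -> : [~ a * x, b] = [~ a, b] ^ x * [~ x, b] by group_word.
  rewrite conjRg !xE// (_ : [~ x, b] = 1) ?mulg1//; apply/eqP.
  by rewrite commg1_sym -conjg_fix xE.
have Gb : G b by case: rb.
have Ga : G a by case: ra.
have Nax : N (a * x).
  rewrite (_ : a * x = (g^-1) ^ a^-1 * g); last by rewrite /x; group_word.
  apply: subgroupM => //; apply: nN; exact: subgroupV.
rewrite commgEl; apply: subgroupM => //; first exact: subgroupV.
exact: nN.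
Qed.

(** The commutators of the rigid stabiliser of the level of a vertex moved by [g]
    lie in [N]: those below that vertex by [rist_commutator], the others by
    transitivity, and rigid stabilisers of distinct vertices commute. *)
Lemma finite_index_normal G N g : subgroup G -> fin_gen G -> branch G ->
  (forall x, G x -> torsion x) -> normal_in N G -> N g -> g <> 1 ->
  finite_index N G.
Proof.
move=> sG fG [tG _ iG] torG nN Ng /aut_neq1[w gw].
have [[sN NG] jN] := nN.
pose n := size w; have lw : level n w by [].
pose R := rist_level G n; have sR : subgroup R by apply: gen_subgroup.
have RG : R `<=` G by apply: gen_sub => // x [v _ []].
have fR : finite_index R G by apply: iG.
have RN x y : R x -> R y -> N [~ x, y].
  move: x y; apply: (gen_commutators sN) => [x h Nx /RG|]; first exact: jN.
  move=> a b [u lu ra] [v lv rb].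
  have suv : size u = size v by rewrite lu lv.
  have [uv|uv] := pselect (u = v); last first.
    have /commgP/eqP-> : commute a b := rist_commute suv uv ra rb.
    by case: sN.
  subst v; have [h Gh hw] := tG n u w lu lw.
  apply: (@normalJV _ N G [~ a, b] h^-1) => //; last exact: subgroupV.
  rewrite conjRg; apply: (rist_commutator sG nN Ng gw); rewrite -hw; exact: ristJ.
have sNR : subgroup (N `&` R) by apply: subgroupI.
have fNR : finite_index (N `&` R) R.
  apply: finite_index_torsion_abelian => //.
  - exact: (fin_gen_finite_index sG fG (conj sR RG) fR).
  - move=> x y Rx Ry; split; first exact: (RN x y Rx Ry).
    rewrite commgEl; apply: (subgroupM sR); first exact: (subgroupV sR).
    exact: (subgroupJ sR).
  - by move=> x /RG/torG.
have fNRG := finite_index_trans sNR sR fNR fR.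
by apply: (finite_indexS sNR sN _ _ fNRG) => // x [].
Qed.

(** * The inductive class *)

(** [A s] is the subgroup of [K] on which the sections at the vertices of [s] are
    trivial.  Starting from [A [::] = K], it shrinks to the trivial subgroup as
    [s] grows to the whole first level, while normal subgroups of [H] stay
    finitely generated and closed modulo [A s]. *)
Lemma normal_fin_gen_closed_stab1 G H : subgroup G -> self_similar G ->
  subgroup_of H (stab G (level 1)) ->
  (forall v M, level 1 v -> normal_in M (section_set H v) ->
     fin_gen M /\ profinite_closed G M) ->
  forall N, normal_in N H -> fin_gen N /\ profinite_closed G N.
Proof.
move=> sG ssG sHS HP; have oK := open_subgroup_stab1 sG.
set K := stab G (level 1) in sHS oK *; have sK : subgroup K by apply: stab1_subgroup.
have [sH HK] := sHS.
pose A (s : seq (word d)) := [set g | K g /\ forall v, v \in s -> section g v = 1].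
have AP s : (forall v, v \in s -> level 1 v) -> normal_in (A s) K /\
    forall N, normal_in N H ->
      (exists2 t : seq (aut d), [set` t] `<=` N & N `<=` mulset (gen [set` t]) (A s)) /\
      profinite_closed K (mulset N (A s)).
  elim: s => [|v s IH] sl.
    have -> : A [::] = K by apply/seteqP; split=> [x []//|x Kx]; split.
    split; first exact: normal_refl.
    move=> N [[sN NH] _]; have NK : N `<=` K by move=> x /NH/HK.
    split.
      by exists [::] => // x /NK Kx; apply: sub_mulsetr Kx; apply: gen_subgroup.
    have -> : mulset N K = K.
      by apply/seteqP; split; [apply: mulset_sub|apply: sub_mulsetr].
    exact/closed_open_subgroup/open_subgroup_refl.
  have lv : level 1 v by apply: sl; apply: mem_head.
  have [|nAs IHs] := IH; first by move=> u us; apply: sl; rewrite inE us orbT.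
  have fM := @stab1_sectionM G v lv; rewrite -/K in fM.
  have fG g : K g -> G (section g v) by move=> [/ssG].
  have -> : A (v :: s) = kernel K (fun g => section g v) `&` A s.
    apply/seteqP; split=> [g [Kg gP]|g [[Kg gv] [_ gs]]].
      split; first by split=> //; apply/gP/mem_head.
      by split=> // u us; apply: gP; rewrite inE us orbT.
    by split=> // u; rewrite inE => /orP[/eqP->|/gs].
  have nB := kernel_normal sK fM.
  have BP N : normal_in N H -> fin_gen ((fun g => section g v) @` N) /\
      profinite_closed G ((fun g => section g v) @` N).
    by move=> nN; apply: (HP v) => //; apply: (image_normal sK fM).
  have sub N : normal_in N H -> subgroup_of N K.
    by move=> [[sN NH] _]; split=> // x /NH/HK.
  split; first by apply: normal_meet nAs _.
  move=> N nN; split.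
    apply: (fin_gen_mod_meet HK nB _ _ nN) => M nM; last by case: (IHs M nM).
    by apply: (fin_gen_mod_kernel sK fM (sub M nM)); case: (BP M nM).
  apply: (closed_mod_meet sK sHS nB nAs _ _ nN) => M nM; last by case: (IHs M nM).
  by apply: (closed_mod_kernel sK fM sG fG (sub M nM)); case: (BP M nM).
move=> N nN; have [[sN NH] _] := nN.
have [|_ /(_ N nN)[[t tN Nt] cN]] := AP [seq [:: i] | i <- enum 'I_d].
  by move=> v /level1P.
have A1 : A [seq [:: i] | i <- enum 'I_d] `<=` [set 1].
  move=> g [Sg gP]; apply: (stab1_section_eq1 Sg) => v lv.
  by apply: gP; apply/level1P.
have mulA M : mulset M (A [seq [:: i] | i <- enum 'I_d]) `<=` M.
  by move=> g [m Mm /A1 /mulg1_eq E]; rewrite -E invgK.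
split.
  by apply/(fin_genP sN); exists t => // x /Nt/mulA.
apply: (closed_trans sG oK); suff <- : mulset N (A [seq [:: i] | i <- enum 'I_d]) = N.
  by [].
apply/seteqP; split; first exact: mulA.
apply: sub_mulsetl; have [] := AP [seq [:: i] | i <- enum 'I_d].
  by move=> v /level1P.
by move=> [[]].
Qed.

End Tree.

Theorem theorem3p19 (d : nat) (hd : (2 <= d)%N) (G : set (aut d))
    (G_subgroup : subgroup G) (G_fin_gen : fin_gen G)
    (G_self_similar : self_similar G) (G_branch : branch G)
    (G_induction : subgroup_induction G) :
  (forall H N : set (aut d), subgroup_of H G -> fin_gen H -> normal_in N H ->
     fin_gen N /\ profinite_closed G N) /\
  subgroup_separable G.
Proof.
have torG := torsion_subgroup_induction G_subgroup G_self_similar G_branch G_induction.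
pose X := [set H : set (aut d) | subgroup_of H G /\
  forall N, normal_in N H -> fin_gen N /\ profinite_closed G N].
have fc1 : fin_gen [set (1 : aut d)] /\ profinite_closed G [set 1].
  split; last exact: closed_set1.
  apply/(fin_genP (subgroup1 _)); exists [::] => // _ ->.
  by case: (gen_subgroup [set` ([::] : seq (aut d))]).
have iX : inductive_class G X.
  split.
  - by move=> H [].
  - split; first by split; [exact: subgroup1|move=> _ ->; case: G_subgroup].
    move=> N [[[N1 _] Nsub] _]; suff -> : N = [set 1] by [].
    by apply/seteqP; split=> // _ ->.
  - split=> [|N nN]; first by split.
    have [sNG _] := nN; have [sN NG] := sNG.
    have [[g [Ng g1]]|nE] := pselect (exists g, N g /\ g <> 1).
      have fN : finite_index N G by apply: finite_index_normal Ng g1.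
      split; first exact: fin_gen_finite_index fN.
      exact: closed_open_subgroup.
    suff -> : N = [set 1] by [].
    apply/seteqP; split=> [x Nx|_ ->]; last by case: sN.
    by apply: contrapT => x1; apply: nE; exists x.
  - move=> H L [sL LG] [sH HL] fH [_ HX]; split=> // N [[sN NL] nN].
    have nHN : normal_in (H `&` N) H.
      split; first by split; [apply: subgroupI|move=> x []].
      by move=> x h [Hx Nx] Hh; split; [apply: subgroupJ|apply/nN/HL].
    have [fgM cM] := HX _ nHN.
    have sM : subgroup_of (H `&` N) N by case: nHN => -[sM _] _; split=> // x [].
    have fM : finite_index (H `&` N) N by apply: finite_index_trace fH.
    split; first exact: fin_gen_supergroup fM fgM.
    by apply: closed_supergroup fM cM => //; split=> // x /NL/LG.
  - move=> H [sH HS] _ HX; split; first by split=> // x /HS[].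
    apply: normal_fin_gen_closed_stab1 => // v M lv nM.
    by have [_] := HX v lv; apply.
have all H N : subgroup_of H G -> fin_gen H -> normal_in N H ->
    fin_gen N /\ profinite_closed G N.
  by move=> sH fH; have [_] := G_induction X iX H sH fH; apply.
split=> // H sH fH; have [sH' _] := sH.
by have [] := all H H sH fH (normal_refl sH').
Qed.
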